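(* For every integer $k\ge 3$, there exist $k$-graphs $F_1$ and $F_2$ such that \[0<\gamma(\{F_1,F_2\})<\min\{\gamma(F_1),\gamma(F_2)\}.\]
   Context: A $k$-graph ($k$-uniform hypergraph) $H$ consists of a vertex set $V(H)$ and an edge set $E(H)\subseteq\binom{V(H)}{k}$. For a $(k-1)$-subset $S\subseteq V(H)$, $d_H(S)$ is the number of edges of $H$ containing $S$. The minimum codegree $\delta_{k-1}(H)$ is the minimum of $d_H(S)$ over all $(k-1)$-subsets $S$ of $V(H)$. For a family $\mathcal{F}$ of $k$-graphs, a $k$-graph is $\mathcal{F}$-free if it contains no member of $\mathcal{F}$ as a (not necessarily induced) subgraph. The codegree Turán number $\mathrm{co\text{-}ex}(n,\mathcal{F})$ is the maximum of $\delta_{k-1}(H)$ over all $n$-vertex $\mathcal{F}$-free $k$-graphs $H$, and the codegree Turán density is $\gamma(\mathcal{F})=\lim_{n\to\infty}\mathrm{co\text{-}ex}(n,\mathcal{F})/n$ (this limit is known to exist). For a single $k$-graph $F$, $\gamma(F)=\gamma(\{F\})$. *)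

(* Defs.v *)
From HB Require Import structures.
From mathcomp Require Import all_boot all_order all_algebra.
From mathcomp Require Import all_classical all_reals all_analysis.
Import Order.TTheory GRing.Theory Num.Theory.
Import numFieldNormedType.Exports.

Set Implicit Arguments.
Unset Strict Implicit.
Unset Printing Implicit Defensive.

Local Open Scope ring_scope.
Local Open Scope classical_set_scope.

Record kgraph_on (k : nat) (V : finType) : Type := KGraphOn {
  edges : {set {set V}};
  edges_uniform : [forall e in edges, #|e| == k]
}.

HB.instance Definition _ k V := [isSub for @edges k V].
HB.instance Definition _ k V := [Finite of kgraph_on k V by <:].

(* Vertex sets are taken to be ordinals, which loses nothing up to isomorphism
   and keeps the type small enough for set (kgraph k) to be well-typed. *)
Record kgraph (k : nat) : Type := KGraph {
  nvertices : nat;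
  graph_of :> kgraph_on k 'I_nvertices
}.

Definition codegree (k : nat) (V : finType) (H : kgraph_on k V) (S : {set V}) :
    nat :=
  #|[set e in edges H | S \subset e]%SET|.

(* A codegree is at most #|V| when k > 0, so the default value of the minimum
   matters only when V has no subset of size k.-1. *)
Definition min_codegree (k : nat) (V : finType) (H : kgraph_on k V) : nat :=
  \big[minn/#|V|]_(S : {set V} | #|S| == k.-1) codegree H S.

Definition contains (k : nat) (V : finType) (H : kgraph_on k V) (F : kgraph k) :
    Prop :=
  exists2 f : 'I_(nvertices F) -> V, injective f &
    forall e : {set 'I_(nvertices F)}, e \in edges F ->
      [set f x | x in e]%SET \in edges H.

Definition free (k : nat) (Fam : set (kgraph k)) (V : finType)
    (H : kgraph_on k V) : Prop :=
  forall F : kgraph k, Fam F -> ~ contains H F.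

(* The maximum is 0 if no k-graph on n vertices is Fam-free, which
   happens only if some member of Fam has no edges. *)
Definition co_ex (k : nat) (Fam : set (kgraph k)) (n : nat) : nat :=
  \max_(H : kgraph_on k 'I_n | `[< free Fam H >]) min_codegree H.

(* lim returns 0 on a divergent sequence, so a positive value certifies that the
   limit exists. *)
Definition codegree_density (R : realType) (k : nat) (Fam : set (kgraph k)) : R :=
  lim ((fun n : nat => (co_ex Fam n)%:R / n%:R : R) @ \oo).

(* Main.v *)
(** Write [G_1] for a single edge, and let [G_(p+1)] consist of a large vertex
    set [W] together with, for each (k-1)-subset [J] of [W], a private copy of
    [G_p] all of whose vertices extend [J] to an edge.  Then [G_p] is not weakly
    p-colourable: a large colour class of [W] contains some [J], and if no mono
    edge extends it then the copy attached to [J] misses one colour.  Take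
    [F1 = G_3].  The 3-partite construction with all non-monochromatic edges is
    [F1]-free, so [gamma(F1) >= 2/3].

    Conversely, an [F1]-free graph on [n] vertices with codegree about [2n/3]
    is close to that construction: up to boundedly many vertices, some
    neighbourhood of a (k-1)-set in any large set contains no
    [G_2], some neighbourhood inside it is independent, and iterating gives
    three disjoint independent sets of size about [n/3]; every (k-1)-set inside
    one of them is then joined to almost everything outside it.  Hence it
    contains [F2], the graph on [L] rounds of three points each, where (k-1)
    points of one kind and a later point of another kind form an edge.

    On the other hand [gamma(F2) >= 7/10].  Colour the vertices by Z/10 and
    forbid, besides monochromatic edges, those with k-1 vertices of colour [a]
    and one of colour [a + 2] or [a + 4].  If [F2] embedded, then some triple of
    colours would repeat in many rounds, giving three colours no two of which
    are related by a forbidden pair in either direction; but two of them have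
    the same parity.

    Intersecting the two constructions shows that the joint density is positive.
    The limits exist because a random m-subset of a graph approximately inherits
    its minimum codegree (Chernoff bound). *)

Require Import Defs.
From mathcomp Require Import all_boot all_order all_algebra.
From mathcomp Require Import boolp zify.

Set Implicit Arguments.
Unset Strict Implicit.
Unset Printing Implicit Defensive.

(** * Embeddings, suspensions and weak colourings *)

Section Basics.
Variables (k : nat) (V : finType).
Implicit Types (H : kgraph_on k V) (S U Z : {set V}).

Definition nbhd H S : {set V} := [set v | (v \notin S) && (v |: S \in edges H)].

Lemma edge_card H e : e \in edges H -> #|e| = k.
Proof. by move=> eH; have /forallP/(_ e)/implyP/(_ eH)/eqP := edges_uniform H. Qed.

Lemma codegreeE H S : 0 < k -> #|S| = k.-1 -> codegree H S = #|nbhd H S|.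
Proof.
move=> k0 cS; rewrite /codegree.
have -> : [set e in edges H | S \subset e] = [set v |: S | v in nbhd H S].
  apply/setP => e; rewrite inE; apply/andP/imsetP => [[eH sSe]|[v]].
    have /eqP/cards1P[v ev] : #|e :\: S| = 1.
      rewrite cardsD (setIidPr sSe) cS (edge_card eH); lia.
    have : v \in e :\: S by rewrite ev set11.
    rewrite inE => /andP[vS _].
    have E : e = v |: S by rewrite -ev setUC; apply/setP => x; rewrite !inE;
       have := subsetP sSe x; case: (x \in S) => // ->.
    by exists v; rewrite // inE vS -E.
  by rewrite inE => /andP[vS vH] ->; rewrite vH subsetUr.
apply: card_in_imset => u v; rewrite !inE => /andP[uS _] /andP[vS _] E.
have : u \in v |: S by rewrite -E setU11.
by rewrite !inE (negPf uS) orbF => /eqP.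
Qed.

Lemma min_codegree_le H S : #|S| = k.-1 -> min_codegree H <= codegree H S.
Proof.
move=> /eqP cS; rewrite /min_codegree.
have := mem_index_enum S; elim: (index_enum _) => // T r IH.
rewrite in_cons big_cons => /predU1P[<-|/IH h]; first by rewrite cS geq_minl.
by case: ifP => // _; rewrite geq_min h orbT.
Qed.

(** The bound by [#|V|] covers the default value in [min_codegree]. *)
Lemma min_codegree_ge H d : d <= #|V| ->
  (forall S, #|S| = k.-1 -> d <= codegree H S) -> d <= min_codegree H.
Proof.
move=> dV h; rewrite /min_codegree; elim/big_ind: _ => // [x y|S /eqP /h //].
by rewrite leq_min => -> ->.
Qed.

Lemma min_codegree_leV H : 0 < k -> min_codegree H <= #|V|.
Proof.
move=> k0; rewrite /min_codegree; elim/big_ind: _ => // [x y hx hy|S /eqP cS].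
  by rewrite geq_min hx.
by rewrite codegreeE // max_card.
Qed.

(** Arbitrary finite vertex types let graphs be assembled from sums and products; confining the
    image to [U] replaces passing to induced subgraphs. *)
Definition emb (X : finType) (G : kgraph_on k X) H U :=
  exists f : X -> V, [/\ injective f, forall x, f x \in U &
    forall e : {set X}, e \in edges G -> f @: e \in edges H].

(** Greedy choice: each new copy has to avoid [B] and the at most [#|I| * #|X|] vertices already
    used. *)
Lemma disjoint_copies (I X : finType) (P : I -> (X -> V) -> Prop) (B : {set V}) :
  (forall i Z, #|Z| <= #|B| + #|I| * #|X| -> exists g : X -> V,
     [/\ injective g, P i g & forall x, g x \notin Z]) ->
  exists g : I -> X -> V, [/\ forall i, P i (g i),
    forall i j x y, g i x = g j y -> i = j /\ x = y & forall i x, g i x \notin B].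
Proof.
move=> h.
(* [g0] only fills the indices not yet treated; it comes from [h], since [V] might be empty. *)
have [g0 _] : exists g0 : I -> X -> V, forall i, P i (g0 i).
  apply: fin_all_exists => i; have [|g [_ ? _]] := h i set0; last by exists g.
  by rewrite cards0.
have copies r : uniq r -> exists g : I -> X -> V,
   [/\ {in r, forall i, P i (g i)}, {in r, forall i x, g i x \notin B} &
    {in r &, forall i j x y, g i x = g j y -> i = j /\ x = y}].
  elim: r => [_|i r IH /= /andP[ir ur]]; first by exists g0.
  have [g [gP gB gI]] := IH ur.
  pose Z := B :|: \bigcup_(j in r) [set g j x | x in X].
  have leZ : #|Z| <= #|B| + #|I| * #|X|.
    apply: leq_trans (leq_card_setU _ _) _; rewrite leq_add2l.
    apply: leq_trans (_ : \sum_(j in r) #|X| <= _).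
      elim/big_rec2: _ => [|j m A _ leA]; first by rewrite cards0.
      apply: leq_trans (leq_card_setU _ _) _; apply: leq_add leA.
      exact: leq_imset_card.
    by rewrite sum_nat_const leq_mul2r max_card orbT.
  have [g' [g'I g'P g'Z]] := h i Z leZ.
  have g'r x j y : j \in r -> g' x <> g j y.
    move=> jr E; have /negP := g'Z x; apply; rewrite E inE; apply/orP; right.
    by apply/bigcupP; exists j => //; apply: imset_f.
  exists (fun j => if j == i then g' else g j); split.
  - move=> j; rewrite inE; case: eqP => [-> //|_ /=]; exact: gP.
  - move=> j; rewrite inE; case: eqP => [_ _ x|_ /=]; last exact: gB.
    by apply: contra (g'Z x) => gxB; rewrite inE gxB.
  - move=> j l; rewrite !inE.
    case: eqP => [->|_ /=] jr; case: eqP => [->|_ /=] lr x y.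
    + by move/g'I.
    + by move/g'r => /(_ lr).
    + by move/esym/g'r => /(_ jr).
    + exact: gI.
have [g [gP gB gI]] := copies _ (enum_uniq I).
by exists g; split=> [i|i j|i]; [apply: gP|apply: gI|apply: gB]; rewrite mem_enum.
Qed.

End Basics.

Section Transfer.
Variables (k : nat) (X : finType) (G : kgraph_on k X).

Let E : {set {set 'I_#|X|}} := [set enum_rank @: e | e : {set X} in edges G].

Fact ord_edges_uniform : [forall e in E, #|e| == k].
Proof.
apply/forallP => e; apply/implyP => /imsetP[e' e'G ->].
by rewrite card_imset ?(edge_card e'G) //; apply: enum_rank_inj.
Qed.

Definition ord_kgraph : kgraph k := KGraph (KGraphOn ord_edges_uniform).

Lemma contains_ord V (H : kgraph_on k V) : contains H ord_kgraph <-> emb G H setT.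
Proof.
split=> [[f fI fE]|[f [fI _ fE]]].
  exists (f \o enum_rank); split=> // [|e eG].
    by apply: inj_comp fI _; apply: enum_rank_inj.
  by rewrite imset_comp; apply: fE; apply: imset_f.
exists (f \o enum_val) => [|e /imsetP[e' e'G ->]].
  by apply: inj_comp fI _; apply: enum_val_inj.
rewrite -imset_comp (_ : _ @: e' = f @: e') ?fE //.
by apply: eq_imset => x /=; rewrite enum_rankK.
Qed.

End Transfer.

Section EdgeGraph.
Variable k : nat.

Fact single_edge_uniform : [forall e in [set [set: 'I_k]], #|e| == k].
Proof.
by apply/forallP => e; apply/implyP; rewrite inE => /eqP->; rewrite cardsT card_ord.
Qed.

Definition single_edge : kgraph_on k 'I_k := KGraphOn single_edge_uniform.

Lemma emb_single_edge (V : finType) (H : kgraph_on k V) (U e : {set V}) :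
  e \in edges H -> e \subset U -> emb single_edge H U.
Proof.
move=> eH sU; pose f (i : 'I_k) := enum_val (cast_ord (esym (edge_card eH)) i).
have fI : injective f by move=> i j /enum_val_inj/cast_ord_inj.
exists f; split=> // [i|_ /set1P->]; first by apply: (subsetP sU); apply: enum_valP.
suff -> : f @: setT = e by [].
apply/eqP; rewrite eqEcard card_imset // cardsT card_ord (edge_card eH) leqnn andbT.
by apply/subsetP => _ /imsetP[i _ ->]; apply: enum_valP.
Qed.

End EdgeGraph.

Section Step.
Variables (k M : nat) (k_gt0 : 0 < k) (X : finType) (G : kgraph_on k X).

Definition subs : finType := {J : {set 'I_M} | #|J| == k.-1}.

Definition lft (x : 'I_M) : 'I_M + subs * X := inl x.
Definition rgt (j : subs) (x : X) : 'I_M + subs * X := inr (j, x).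

Lemma lft_inj : injective lft. Proof. by move=> x y []. Qed.
Lemma rgt_inj j : injective (rgt j). Proof. by move=> x y []. Qed.

Let E : {set {set 'I_M + subs * X}} :=
  [set rgt p.1 p.2 |: lft @: val p.1 | p : subs * X] :|:
  [set rgt p.1 @: p.2 | p : subs * {set X} & p.2 \in edges G].

Fact suspension_uniform : [forall e in E, #|e| == k].
Proof.
apply/forallP => e; apply/implyP; rewrite inE.
case/orP => /imsetP[[j x]] /=; rewrite ?inE /=.
  move=> _ ->; rewrite cardsU1 card_imset; last exact: lft_inj.
  rewrite (eqP (valP j)) (_ : _ \notin _) ?add1n ?prednK //.
  by apply/imsetP => -[].
by move=> eG ->; rewrite card_imset ?(edge_card eG) //; apply: rgt_inj.
Qed.

Definition suspension : kgraph_on k ('I_M + subs * X)%type := KGraphOn suspension_uniform.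

(** The image of ['I_M] is placed in [W] and each private copy in the matching neighbourhood; [Z]
    stands for [W]-vertices and copies already placed. *)
Lemma emb_suspension (V : finType) (H : kgraph_on k V) (U W : {set V}) :
  W \subset U -> M <= #|W| ->
  (forall S Z : {set V}, S \subset W -> #|S| = k.-1 -> #|Z| <= M + #|subs| * #|X| ->
     emb G H ((nbhd H S :&: U) :\: Z)) ->
  emb suspension H U.
Proof.
move=> sWU leW h.
pose w (i : 'I_M) : V := enum_val (widen_ord leW i).
have wI : injective w.
  by move=> i j /enum_val_inj /(congr1 val) /= ij; apply: val_inj.
have wW i : w i \in W by apply: enum_valP.
pose S (j : subs) := w @: val j.
pose P (j : subs) (g : X -> V) := (forall x, g x \in nbhd H (S j) :&: U) /\
   (forall e : {set X}, e \in edges G -> g @: e \in edges H).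
have [|g [gP gI gB]] := @disjoint_copies V subs X P (w @: setT).
  move=> j Z; rewrite card_imset // cardsT card_ord => leZ.
  have [|| g [gI gU gE]] := h (S j) Z _ _ leZ.
  - by apply/subsetP => _ /imsetP[i _ ->].
  - by rewrite card_imset // (eqP (valP j)).
  by exists g; split=> //; [split=> // x|move=> x]; have := gU x; rewrite inE => /andP[].
exists (fun y => match y with inl i => w i | inr (j, x) => g j x end); split.
- have gw i j x : w i <> g j x.
    by move=> E0; have /negP := gB j x; apply; rewrite -E0 imset_f.
  move=> [i|[j x]] [i'|[j' x']]; first by move/wI->.
  + by move/gw.
  + by move/esym/gw.
  + by case/gI => -> ->.
- move=> [i|[j x]]; first exact: (subsetP sWU).
  by have [+ _] := gP j => /(_ x); rewrite inE => /andP[].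
- move=> e; rewrite inE => /orP[] /imsetP[[j x]] /=; rewrite ?inE /=.
    move=> _ ->; rewrite imsetU1 -imset_comp /=.
    by have [+ _] := gP j => /(_ x); rewrite !inE => /andP[/andP[]].
  by move=> eG ->; rewrite -imset_comp; have [_] := gP j; apply.
Qed.

End Step.

(** Colours range over a subset [D] of a fixed type, so that an induction on [p] can delete a colour
    without changing the type. *)
Definition not_colorable (k : nat) (X C : finType) (G : kgraph_on k X) (p : nat) :=
  forall (c : X -> C) (D : {set C}), #|D| <= p -> (forall x, c x \in D) ->
  exists e r, e \in edges G /\ {in e, forall x, c x = r}.

Lemma not_colorable_single_edge (k : nat) (C : finType) :
  0 < k -> not_colorable C (single_edge k) 1.
Proof.
case: k => // k _ c D D1 cD; exists setT, (c ord0); split; first exact: set11.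
by move=> x _; apply: (card_le1_eqP D1).
Qed.

Lemma subset_of_card (T : finType) (A : {set T}) n :
  n <= #|A| -> exists2 B : {set T}, B \subset A & #|B| = n.
Proof.
move=> nA; have /card_gt0P[B] : 0 < #|[set B : {set T} | B \subset A & #|B| == n]|.
  by rewrite cards_draws bin_gt0.
by rewrite inE => /andP[sB /eqP]; exists B.
Qed.

Lemma pigeonhole_fiber (T T' : finType) (f : T -> T') (D : {set T'}) n :
  (forall x, f x \in D) -> #|D| * n < #|T| -> exists r, n < #|[set x | f x == r]|.
Proof.
move=> fD lt; apply/existsP; apply: contraLR lt => /existsPn h.
rewrite -leqNgt -cardsT -sum1_card (partition_big f (mem D)) //=.
rewrite -sum_nat_const; apply: leq_sum => r _.
have := h r; rewrite -leqNgt; apply: leq_trans; rewrite sum1dep_card.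
by apply: subset_leq_card; apply/subsetP => x; rewrite !inE.
Qed.

Lemma not_colorable_suspension (k M p : nat) (k_gt0 : 0 < k) (X C : finType)
    (G : kgraph_on k X) :
  p.+1 * k < M -> not_colorable C G p -> not_colorable C (suspension M k_gt0 G) p.+1.
Proof.
move=> ltM hG c D leD cD.
have [||r ltr] := @pigeonhole_fiber _ _ (c \o @lft k M X) D k.
- by move=> x; apply: cD.
- by rewrite card_ord; apply: leq_ltn_trans ltM; rewrite leq_mul2r leD orbT.
have [J sJ /eqP cJ] : exists2 J : {set 'I_M}, J \subset [set x | (c \o @lft k M X) x == r]
    & #|J| = k.-1.
  by apply: subset_of_card; apply: leq_trans (leq_pred k) (ltnW ltr).
pose j : subs k M := exist _ J cJ.
have cr x : x \in J -> c (inl x) = r by move/(subsetP sJ); rewrite inE => /eqP.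
have [/existsP[x /eqP cx]|nr] := boolP [exists x, c (rgt j x) == r].
  exists (rgt j x |: @lft k M X @: J), r; split.
    by rewrite inE; apply/orP; left; apply/imsetP; exists (j, x).
  by move=> y /setU1P[->//|/imsetP[i iJ ->]]; apply: cr.
(* The class of [r] is nonempty, so deleting [r] really leaves at most [p] colours for the copy
   attached to [J]. *)
have rD : r \in D.
  have [x] : exists x, x \in [set x | (c \o @lft k M X) x == r].
    by apply/card_gt0P; apply: leq_ltn_trans ltr.
  by rewrite inE => /eqP<-; apply: cD.
have [||e [s [eG es]]] := hG (c \o rgt j) (D :\ r).
- by move: leD; rewrite (cardsD1 r) rD.
- by move=> x; rewrite !inE cD andbT; apply: contra nr => /= /eqP E; apply/existsP; exists x; apply/eqP.
exists (rgt j @: e), s; split; last by move=> _ /imsetP[x xe ->]; apply: es.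
by rewrite inE; apply/orP; right; apply/imsetP; exists (j, e) => //; rewrite inE.
Qed.

(** * The layered graph and its greedy embedding *)

Section Layers.
Variables (k L : nat) (k_gt0 : 0 < k).

Let pt := ('I_L * 'I_3)%type.

Definition layer_edge (J : {set 'I_L}) (j : 'I_L) (s t : 'I_3) : {set pt} :=
  (j, s) |: [set (i, t) | i in J].

(** The order [i < j] means that a point is constrained only by earlier rounds, which allows
    embedding round by round. *)
Definition layer_ok (J : {set 'I_L}) (j : 'I_L) (s t : 'I_3) :=
  [&& #|J| == k.-1, [forall i in J, i < j] & s != t].

Let E : {set {set pt}} :=
  [set layer_edge p.1.1 p.1.2 p.2.1 p.2.2 |
    p : ({set 'I_L} * 'I_L) * ('I_3 * 'I_3) & layer_ok p.1.1 p.1.2 p.2.1 p.2.2].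

Fact layers_uniform : [forall e in E, #|e| == k].
Proof.
apply/forallP => e; apply/implyP => /imsetP[[[J j] [s t]]].
rewrite inE => /and3P[/eqP cJ _ /= st] ->.
rewrite cardsU1 card_imset => [|i i' []//]; rewrite cJ.
rewrite (_ : _ \notin _) ?add1n ?prednK //.
by apply/imsetP => -[i _ [_ E0]]; rewrite E0 eqxx in st.
Qed.

Definition layers : kgraph_on k pt := KGraphOn layers_uniform.

Lemma layersP e : reflect (exists J j s t, layer_ok J j s t /\ e = layer_edge J j s t)
  (e \in edges layers).
Proof.
apply: (iffP imsetP) => [[[[J j] [s t]]]|[J [j [s [t [ok ->]]]]]].
  by rewrite inE => ok ->; exists J, j, s, t.
by exists ((J, j), (s, t)); rewrite ?inE.
Qed.

(** Greedy embedding: a new point of kind [s] avoids the at most [L] earlier points of its kind and,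
    for each pair of a kind and a set of rounds, at most [m] non-neighbours. *)
Lemma emb_layers (V : finType) (H : kgraph_on k V) (A : 'I_3 -> {set V}) (m : nat) :
  (forall s t, s != t -> [disjoint A s & A t]) ->
  (forall s t (S : {set V}), s != t -> S \subset A t -> #|S| = k.-1 ->
     #|A s :\: nbhd H S| <= m) ->
  (forall s, L + #|{: 'I_3 * {set 'I_L}}| * m < #|A s|) ->
  emb layers H setT.
Proof.
move=> disA missA ltA.
(* Rounds are indexed by [nat], so that adding one does not change the type of [f]; values from [l]
   on are arbitrary. *)
have step l : l <= L -> exists f : nat -> 'I_3 -> V,
   [/\ forall i s, i < l -> f i s \in A s,
       forall i j s, i < j -> j < l -> f i s != f j s &
       forall J (j : 'I_L) s t, j < l -> layer_ok J j s t ->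
         f j s \in nbhd H [set f (val i) t | i in J]].
  elim: l => [_|l IH ltl].
    have /fin_all_exists[f _] : forall s : 'I_3, exists v, v \in A s.
      by move=> s; apply/card_gt0P; apply: leq_ltn_trans (leq0n _) (ltA s).
    by exists (fun=> f); split.
  have [f [fA fI fE]] := IH (ltnW ltl).
  pose okT (s : 'I_3) (q : 'I_3 * {set 'I_L}) := layer_ok q.2 (Ordinal ltl) s q.1.
  pose bad s := [set f (val i) s | i : 'I_L in 'I_L] :|:
    \bigcup_(q | okT s q) (A s :\: nbhd H [set f (val i) q.1 | i in q.2]).
  have leb s : #|bad s| <= L + #|{: 'I_3 * {set 'I_L}}| * m.
    apply: leq_trans (leq_card_setU _ _) _; apply: leq_add.
      by apply: leq_trans (leq_imset_card _ _) _; rewrite card_ord.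
    apply: leq_trans (_ : \sum_(q | okT s q) m <= _).
      elim/big_rec2: _ => [|[t J] n B /and3P[/eqP cJ /forallP/= ltJ st] leB].
        by rewrite cards0.
      apply: leq_trans (leq_card_setU _ _) _; apply: leq_add leB.
      have ltJl i : i \in J -> i < l by move=> iJ; have := ltJ i; rewrite iJ.
      apply: (missA s t) => //.
        by apply/subsetP => _ /imsetP[i /ltJl il ->]; apply: fA.
      rewrite card_in_imset // => i i' iJ i'J E0; apply/eqP.
      have [lt|lt|/val_inj->//] := ltngtP i i'.
        by have := fI _ _ t lt (ltJl _ i'J); rewrite E0 eqxx.
      by have := fI _ _ t lt (ltJl _ iJ); rewrite E0 eqxx.
    by rewrite sum_nat_const leq_mul2r max_card orbT.
  have /fin_all_exists[g gP] : forall s : 'I_3, exists v, v \in A s :\: bad s.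
    move=> s; apply/card_gt0P.
    have := leq_ltn_trans (leb s) (ltA s).
    have := cardsID (bad s) (A s); have := subset_leq_card (subsetIr (A s) (bad s)).
    lia.
  have gA s : g s \in A s by have := gP s; rewrite inE => /andP[].
  have gbad s : g s \notin bad s by have := gP s; rewrite inE => /andP[].
  (* The base of an edge with apex in a round up to [l] lies in rounds before [l], where [f] is
     unchanged. *)
  have imE (J : {set 'I_L}) (j : 'I_L) t : j <= l -> [forall i in J, i < j] ->
     [set (if val i == l then g else f (val i)) t | i in J] =
     [set f (val i) t | i in J].
    move=> jl /forallP ltJ; apply: eq_in_imset => i iJ.
    have := ltJ i; rewrite iJ => /= ij; case: eqP => //= il; lia.
  exists (fun i => if i == l then g else f i); split.
  - move=> i s; rewrite ltnS leq_eqVlt; case: eqP => //= _; exact: fA.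
  - move=> i j s ij; rewrite ltnS leq_eqVlt.
    case: (j =P l) => [jl _|_ /= jl]; last first.
      by rewrite ltn_eqF ?fI //; apply: ltn_trans ij jl.
    have il : i < l by rewrite -jl.
    rewrite (ltn_eqF il); apply: contra (gbad s) => /eqP <-.
    rewrite inE; apply/orP; left.
    by apply/imsetP; exists (Ordinal (ltn_trans il ltl)).
  - move=> J j s t; rewrite ltnS => jl ok.
    have /and3P[cJ ltJ st] := ok.
    rewrite (imE _ j) //; have [ejl|njl] := eqVneq (val j) l; last first.
      by apply: fE => //; rewrite ltn_neqAle njl.
    have ej : j = Ordinal ltl by apply: val_inj.
    have := gbad s; rewrite inE negb_or => /andP[_ nb].
    apply: contraR nb => nb; apply/bigcupP; exists (t, J); first by rewrite /okT -ej.
    by rewrite inE nb gA.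
have [f [fA fI fE]] := step L (leqnn L).
exists (fun p : pt => f (val p.1) p.2); split=> //.
- move=> [i s] [j t] /= E0.
  have st : s = t.
    apply/eqP; apply: contraT => /disA /disjointFr /(_ (fA i s (ltn_ord i))).
    by rewrite E0 fA.
  rewrite -st in E0 *; have [lt|lt|/val_inj->//] := ltngtP i j.
    by have := fI _ _ s lt (ltn_ord j); rewrite E0 eqxx.
  by have := fI _ _ s lt (ltn_ord i); rewrite E0 eqxx.
- move=> e /layersP[J [j [s [t [ok ->]]]]].
  rewrite imsetU1 -imset_comp.
  by have := fE J j s t (ltn_ord j) ok; rewrite inE => /andP[].
Qed.

End Layers.

(** * The upper bound for the pair *)

Lemma not_emb_colored (k p : nat) (V X C : finType) (H : kgraph_on k V)
    (G : kgraph_on k X) (c : V -> C) :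
  #|C| <= p -> not_colorable C G p ->
  (forall e, e \in edges H -> exists x y, [/\ x \in e, y \in e & c x != c y]) ->
  ~ emb G H setT.
Proof.
move=> Cp hG hH [f [_ _ fE]].
have [||e [r [eG er]]] := hG (c \o f) setT; rewrite ?cardsT //.
have [_ [_ [/imsetP[x xe ->] /imsetP[y ye ->]]]] := hH _ (fE e eG).
by rewrite -[c (f x)]/((c \o f) x) -[c (f y)]/((c \o f) y) !er ?eqxx.
Qed.

Section UpperBound.
Variables (k M : nat) (k_gt0 : 0 < k) (V : finType) (H : kgraph_on k V).
Implicit Types (S U W Z : {set V}).

(** Absence of edges inside [U], phrased so that the neighbourhood of a (k-1)-subset of [U] is at
    once disjoint from [U]. *)
Definition independent U :=
  forall S, S \subset U -> #|S| = k.-1 -> [disjoint U & nbhd H S].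

Lemma independent_not_emb U : ~ emb (single_edge k) H U -> independent U.
Proof.
move=> nU S sSU cS; apply/pred0P => v /=; apply/negP => /andP[vU].
rewrite inE => /andP[_ vS]; apply: nU; apply: emb_single_edge vS _.
by apply/subsetP => x /setU1P[->//|/(subsetP sSU)].
Qed.

Lemma not_emb_suspension (X : finType) (G : kgraph_on k X) U W :
  ~ emb (suspension M k_gt0 G) H U -> W \subset U -> M <= #|W| ->
  exists S Z, [/\ S \subset W, #|S| = k.-1, #|Z| <= M + #|subs k M| * #|X| &
    ~ emb G H ((nbhd H S :&: U) :\: Z)].
Proof.
move=> nU sWU leW; apply: contrapT => nex; apply: nU.
apply: emb_suspension sWU leW _ => S Z sS cS cZ.
by apply: contrapT => nG; apply: nex; exists S, Z; split.
Qed.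

Let susp1 := suspension M k_gt0 (single_edge k).
Let susp2 := suspension M k_gt0 susp1.

(** Each passage to a smaller forbidden graph deletes at most [c] vertices. Intersecting two
    neighbourhoods of size [d] costs [#|V| - d] more, hence the size [2 * d - #|V| - 2 * c]. *)
Lemma three_parts (c d : nat) :
  M + #|subs k M| * k <= c -> M + #|subs k M| * (M + #|subs k M| * k) <= c ->
  d <= #|V| -> (forall S, #|S| = k.-1 -> d <= #|nbhd H S|) ->
  #|V| + 2 * c + M <= 2 * d ->
  ~ emb susp2 H setT ->
  exists A : 'I_3 -> {set V}, [/\ forall s t, s != t -> [disjoint A s & A t],
    forall s, independent (A s) & forall s, 2 * d - #|V| - 2 * c <= #|A s|].
Proof.
move=> lec1 lec2 leV led ltd nH.
have big2 W : M <= #|W| -> exists S U, [/\ S \subset W, #|S| = k.-1,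
    U \subset nbhd H S, d <= #|U| + c & ~ emb susp1 H U].
  move=> leW; have [S [Z [sS cS cZ nU]]] := not_emb_suspension nH (subsetT W) leW.
  exists S, ((nbhd H S :&: setT) :\: Z); split=> //.
    by rewrite setIT subsetDl.
  have := led S cS; have := cardsID Z (nbhd H S).
  have := subset_leq_card (subsetIr (nbhd H S) Z).
  rewrite setIT.
  have := cZ; rewrite card_sum card_prod !card_ord; lia.
have big1 (U W : {set V}) : ~ emb susp1 H U -> W \subset U -> M <= #|W| -> exists S B : {set V},
    [/\ S \subset W, #|S| = k.-1, B \subset nbhd H S :&: U,
        d + #|U| <= #|B| + c + #|V| & independent B].
  move=> nU sWU leW; have [S [Z [sS cS cZ nB]]] := not_emb_suspension nU sWU leW.
  exists S, ((nbhd H S :&: U) :\: Z); split=> //; first exact: subsetDl.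
    have := led S cS; have := cardsID Z (nbhd H S :&: U).
    have := subset_leq_card (subsetIr (nbhd H S :&: U) Z).
    have := cardsUI (nbhd H S) U.
    have : #|nbhd H S :|: U| <= #|V| := max_card _.
    move: cZ; rewrite card_ord; lia.
  exact: independent_not_emb.
have sub_dis (U B S W : {set V}) : independent U -> S \subset U -> #|S| = k.-1 ->
    B \subset nbhd H S -> W \subset B -> [disjoint U & W].
  move=> iU sSU cS sB sW; apply: disjointWr (subset_trans sW sB) _.
  exact: iU.
(* [U0] serves only to produce the first independent set [A]. *)
have [|_ [U0 [_ _ _ leU0 nU0]]] := big2 setT; first by rewrite cardsT; lia.
have leU0V : #|U0| <= #|V| := max_card _.
have [||_ [A [_ _ _ leA iA]]] := big1 U0 U0 nU0; rewrite ?subxx //; first lia.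
(* With [S2] inside the independent set [A], the new set [U] and everything found in it is disjoint
   from [A]. *)
have [|S2 [U [sS2 cS2 sU leU nU]]] := big2 A; first lia.
have leUV : #|U| <= #|V| := max_card _.
have [||S3 [B [_ _ sB leB iB]]] := big1 U U nU; rewrite ?subxx //; first lia.
have sBU : B \subset U by apply: subset_trans sB (subsetIr _ _).
(* Searching from a (k-1)-set in [B], but still within [U], makes [C] disjoint from both [B] and
   [A]. *)
have [|S4 [C [sS4 cS4 sC leC iC]]] := big1 U B nU sBU; first lia.
have sCU : C \subset U by apply: subset_trans sC (subsetIr _ _).
have dAB := sub_dis _ _ _ _ iA sS2 cS2 sU sBU.
have dAC := sub_dis _ _ _ _ iA sS2 cS2 sU sCU.
have dBC := sub_dis _ _ _ _ iB sS4 cS4 (subset_trans sC (subsetIl _ _)) (subxx C).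
have szA : 2 * d - #|V| - 2 * c <= #|A| by clear - leU0 leA; lia.
have szB : 2 * d - #|V| - 2 * c <= #|B| by clear - leU leB; lia.
have szC : 2 * d - #|V| - 2 * c <= #|C| by clear - leU leC; lia.
exists (fun s : 'I_3 => nth A [:: A; B; C] s); split.
- by case=> -[|[|[|//]]] ? [] [|[|[|//]]] ? //= _; rewrite // disjoint_sym.
- by case=> -[|[|[|//]]].
- by case=> -[|[|[|//]]].
Qed.

(** The neighbourhood of a (k-1)-set in [A t] is disjoint from [A t], so outside [A t] it misses at
    most [#|V| - #|A t| - d] vertices. By the size of the parts this is at most
    [2 * #|V| + 2 * c - 3 * d], the [m] of [emb_layers]. *)
Lemma joint_upper_bound (L c d : nat) :
  M + #|subs k M| * k <= c -> M + #|subs k M| * (M + #|subs k M| * k) <= c ->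
  d <= #|V| -> (forall S, #|S| = k.-1 -> d <= #|nbhd H S|) ->
  #|V| + 2 * c + M + L +
    #|{: 'I_3 * {set 'I_L}}| * (2 * #|V| + 2 * c - 3 * d) < 2 * d ->
  ~ emb susp2 H setT -> emb (layers L k_gt0) H setT.
Proof.
move=> lec1 lec2 leV led ltd nH.
have [|A [disA iA leA]] := three_parts lec1 lec2 leV led _ nH.
  by move: ltd; set x := _ * (_ - _); lia.
apply: (@emb_layers _ _ _ _ _ A (2 * #|V| + 2 * c - 3 * d)) => // [s t S st sS cS|s].
  have dis : [disjoint A t & nbhd H S] by apply: iA.
  have := led S cS; have := leA t.
  have sub : A s :\: nbhd H S \subset ~: (A t :|: nbhd H S).
    apply/subsetP => x; rewrite !inE negb_or => /andP[-> xA]; rewrite andbT.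
    by rewrite (disjointFr (disA _ _ st) xA).
  have := subset_leq_card sub; have := cardsC (A t :|: nbhd H S).
  have := cardsUI (A t) (nbhd H S).
  have -> : A t :&: nbhd H S = set0 by apply/eqP; rewrite setI_eq0.
  rewrite cards0; lia.
by apply: leq_trans (leA s); move: ltd; set x := _ * (_ - _); lia.
Qed.

End UpperBound.

(** * Labelled constructions *)

(* [b - a] is 0, 2 or 4 modulo 10: among the colours of one parity this is a
   regular tournament together with the diagonal. *)
Definition forbidden_pair (a b : nat) := (b + 10 - a) %% 10 \in [:: 0; 2; 4].

(** Two of the three colours have the same parity, and one of their two differences modulo 10 is 0,
    2 or 4. *)
Lemma forbidden_pair_triple x y z : x < 10 -> y < 10 -> z < 10 ->
  [|| forbidden_pair x y, forbidden_pair y x, forbidden_pair x z, forbidden_pair z x, forbidden_pair y z | forbidden_pair z y].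
Proof.
move=> x10 y10 z10.
have chk : all (fun x => all (fun y => all (fun z => [|| forbidden_pair x y, forbidden_pair y x,
    forbidden_pair x z, forbidden_pair z x, forbidden_pair y z | forbidden_pair z y])
    (iota 0 10)) (iota 0 10)) (iota 0 10) by vm_compute.
have mem t : t < 10 -> t \in iota 0 10 by rewrite mem_iota.
by move/allP/(_ _ (mem _ x10))/allP/(_ _ (mem _ y10))/allP/(_ _ (mem _ z10)) : chk.
Qed.

(** Monochromatic edges are included, because every pair [(a, a)] is forbidden. *)
Definition forbidden_edge (V : finType) (lab : V -> nat) (e : {set V}) :=
  [exists v in e, exists a : 'I_10,
    [forall u in e :\ v, lab u == a] && forbidden_pair a (lab v)].

(** A round has [10 ^ 3] possible colour patterns, so more than [k] rounds share one. *)
Lemma not_emb_layers (k L : nat) (k_gt0 : 0 < k) (V : finType) (H : kgraph_on k V)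
    (lab : V -> nat) :
  1000 * k < L -> (forall v, lab v < 10) ->
  (forall e, e \in edges H -> ~~ forbidden_edge lab e) ->
  ~ emb (layers L k_gt0) H setT.
Proof.
move=> ltL lab10 nbad [f [fI _ fE]].
pose l v : 'I_10 := Ordinal (lab10 v).
pose t (i : 'I_L) : {ffun 'I_3 -> 'I_10} := [ffun s => l (f (i, s))].
have [||r ltr] := @pigeonhole_fiber _ _ t setT k.
- by move=> i; rewrite inE.
- by rewrite cardsT card_ffun !card_ord.
set T := [set x | t x == r] in ltr.
have [j0 j0T] : exists j, j \in T by apply/card_gt0P; apply: leq_ltn_trans ltr.
(* The latest round of the class is the apex, so that all the others precede it as [layer_ok]
   demands. *)
have [j jT jmax] : exists2 j, j \in T & forall i, i \in T -> i <= j.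
  by case: (@arg_maxnP _ j0 (mem T) val j0T) => j jT jmax; exists j.
have [J sJ /eqP cJ] : exists2 J : {set 'I_L}, J \subset T :\ j & #|J| = k.-1.
  apply: subset_of_card; apply: leq_trans (leq_pred k) _.
  by move: ltr; rewrite (cardsD1 j T) jT add1n ltnS.
have labT i s : i \in T -> lab (f (i, s)) = r s.
  by rewrite inE => /eqP<-; rewrite ffunE.
have good s u : s != u -> ~~ forbidden_pair (r u) (r s).
  move=> su.
  have ok : layer_ok k J j s u.
    rewrite /layer_ok cJ su andbT /=; apply/forallP => i; apply/implyP.
    move/(subsetP sJ); rewrite !inE => /andP[ij iT].
    by rewrite ltn_neqAle ij jmax // inE.
  have /nbad : f @: layer_edge J j s u \in edges H.
    by apply: fE; apply/layersP; exists J, j, s, u.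
  apply: contra => bp; apply/existsP; exists (f (j, s)); apply/andP; split.
    by rewrite imset_f ?setU11.
  apply/existsP; exists (r u); apply/andP; split; last by rewrite labT.
  apply/forallP => v; apply/implyP; rewrite /layer_edge imsetU1 !inE.
  case/andP=> /negPf-> /= /imsetP[_ /imsetP[i iJ ->] ->].
  by rewrite labT //; move: (subsetP sJ _ iJ); rewrite inE => /andP[].
pose s0 : 'I_3 := @Ordinal 3 0 isT; pose s1 : 'I_3 := @Ordinal 3 1 isT.
pose s2 : 'I_3 := @Ordinal 3 2 isT.
have := forbidden_pair_triple (ltn_ord (r s0)) (ltn_ord (r s1)) (ltn_ord (r s2)).
by rewrite !(negPf (good _ _ _)).
Qed.

(** * Codegrees of graphs defined by residue classes *)

Section PredGraph.
Variables (k : nat) (V : finType) (P : pred {set V}).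

Let E : {set {set V}} := [set e : {set V} | (#|e| == k) && P e].

Fact pred_edges_uniform : [forall e in E, #|e| == k].
Proof. by apply/forallP => e; apply/implyP; rewrite inE => /andP[]. Qed.

Definition pred_kgraph : kgraph_on k V := KGraphOn pred_edges_uniform.

Lemma pred_nbhd (S : {set V}) : 0 < k -> #|S| = k.-1 ->
  nbhd pred_kgraph S = [set v | (v \notin S) && P (v |: S)].
Proof.
move=> k0 cS; apply/setP => v; rewrite !inE; case: (boolP (v \in S)) => //= vS.
by rewrite cardsU1 vS cS add1n prednK // eqxx.
Qed.

End PredGraph.

Lemma card_residues (q n : nat) (r : seq nat) : 0 < q -> uniq r -> all (gtn q) r ->
  size r * (n %/ q) <= #|[set v : 'I_n | val v %% q \in r]|.
Proof.
move=> q0 ur /allP rq.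
pose s := [seq t * q + x | t <- iota 0 (n %/ q), x <- r].
have us : uniq s.
  apply: allpairs_uniq => //; first exact: iota_uniq.
  move=> [t x] [t' x'] /allpairsP[[t1 x1] [/= _ xr [-> ->]]].
  move=> /allpairsP[[t2 x2] [/= _ xr' [-> ->]]] /= E.
  have /= xq := rq _ xr; have /= xq' := rq _ xr'.
  have E1 := congr1 (modn^~ q) E; have E2 := congr1 (divn^~ q) E; move: E1 E2.
  by rewrite /= !modnMDl !modn_small // !divnMDl // !divn_small // !addn0 => -> ->.
have -> : size r * (n %/ q) = size s by rewrite size_allpairs size_iota mulnC.
have -> : #|[set v : 'I_n | val v %% q \in r]| =
    size (map val (enum [set v : 'I_n | val v %% q \in r])).
  by rewrite size_map -cardE.
apply: uniq_leq_size us _ => _ /allpairsP[[t x] [/= + xr ->]].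
rewrite mem_iota /= => tn; have /= xq := rq _ xr.
have lt : t * q + x < n.
  have := leq_divM n q; have : t.+1 * q <= n %/ q * q by rewrite leq_mul2r tn orbT.
  lia.
apply/mapP; exists (Ordinal lt) => //; rewrite mem_enum inE /=.
by rewrite modnMDl modn_small.
Qed.

(** Each admissible residue contributes [n %/ q] vertices; the summand [k] pays for those lying in
    [S] itself. *)
Lemma residue_codegree (k n q g : nat) (P : pred {set 'I_n}) :
  0 < k -> 0 < q -> (forall S : {set 'I_n}, #|S| = k.-1 -> exists r : seq nat,
    [/\ uniq r, all (gtn q) r, g <= size r &
     forall v, v \notin S -> val v %% q \in r -> P (v |: S)]) ->
  g <= q -> g * (n %/ q) <= min_codegree (pred_kgraph k P) + k.
Proof.
move=> k0 q0 h gq; rewrite addnC -leq_subLR; apply: min_codegree_ge.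
  rewrite card_ord; apply: leq_trans (leq_subr _ _) _.
  by apply: leq_trans (leq_mul gq (leqnn _)) _; rewrite mulnC leq_divM.
move=> S cS; rewrite codegreeE // pred_nbhd //; have [r [ur rq gr hr]] := h S cS.
have := card_residues n q0 ur rq.
set A := [set v : 'I_n | val v %% q \in r] => leA.
set B := [set v | (v \notin S) && P (v |: S)].
have sAB : A \subset B :|: S.
  apply/subsetP => v; rewrite inE => vr; rewrite in_setU; case: (boolP (v \in S)) => vS.
    by rewrite orbT.
  by rewrite orbF inE vS hr.
have leBS := leq_card_setU B S; rewrite cS in leBS.
have leg : g * (n %/ q) <= size r * (n %/ q) by rewrite leq_mul2r gr orbT.
rewrite leq_subLR addnC; apply: leq_trans leg _; apply: leq_trans leA _.
apply: leq_trans (subset_leq_card sAB) _; apply: leq_trans leBS _.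
by rewrite leq_add2l leq_pred.
Qed.

Definition not_mono (n : nat) (e : {set 'I_n}) :=
  [exists x in e, exists y in e, val x %% 3 != val y %% 3].

Lemma not_mono_extend n (S : {set 'I_n}) u v :
  u \in S -> val v %% 3 != val u %% 3 -> not_mono (v |: S).
Proof.
move=> uS vu; apply/existsP; exists v; rewrite setU11 /=.
by apply/existsP; exists u; rewrite vu andbT setU1r.
Qed.

Definition label10 (n : nat) (v : 'I_n) := val v %% 10.

(** Here [a] and [b] are the labels of two vertices of a (k-1)-set and [x] that of an added vertex.
    At least 7 labels pass: 8 if [a != b], and 7 if [a == b]. *)
Definition good_label (a b x : nat) := [&& x != a, x != b & (a == b) ==> ~~ forbidden_pair a x].

(** If [v] is the odd vertex of a forbidden edge, then [u] and [w] share the colour [a], against the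
    last clause of [good_label]. Otherwise [v] has colour [a] together with [u] or [w], against one
    of the first two. *)
Lemma no_forbidden_edge_extend n (S : {set 'I_n}) u w v : u \in S -> w \in S -> u != w ->
  v \notin S -> good_label (label10 u) (label10 w) (label10 v) ->
  ~~ forbidden_edge (@label10 n) (v |: S).
Proof.
move=> uS wS uw vS /and3P[xa xb ab]; apply/existsP => -[v' /andP[v'e]].
case/existsP => a /andP[/forallP ha bp].
have lab_a z : z \in v |: S -> z != v' -> label10 z = a.
  by move=> ze zv'; have := ha z; rewrite !inE zv' -in_setU1 ze => /eqP.
have uv : u \in v |: S by apply: setU1r.
have wv : w \in v |: S by apply: setU1r.
have [E|nE] := eqVneq v' v.
  have ua : label10 u = a by apply: lab_a => //; rewrite E; apply: contraNneq vS => <-.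
  have wa : label10 w = a by apply: lab_a => //; rewrite E; apply: contraNneq vS => <-.
  by move: ab; rewrite ua wa eqxx -E bp.
have va : label10 v = a by apply: lab_a; rewrite ?setU11 // eq_sym.
have [E|nu] := eqVneq u v'.
  by move: xb; rewrite va (lab_a w) ?eqxx // -E eq_sym.
by move: xa; rewrite va (lab_a u) ?eqxx.
Qed.

Section Constructions.
Variables (k : nat) (hk : 3 <= k).

Let k_gt0 : 0 < k. Proof. exact: leq_trans hk. Qed.

(** This is where [k >= 3] enters, rather than [k > 0]. *)
Lemma two_points (V : finType) (S : {set V}) : #|S| = k.-1 ->
  exists u w, [/\ u \in S, w \in S & u != w].
Proof.
move=> cS; have /card_gt1P[u [w [uS wS uw]]] : 1 < #|S| by rewrite cS; lia.
by exists u, w.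
Qed.

Lemma min_codegree_not_mono n :
  2 * (n %/ 3) <= min_codegree (pred_kgraph k (@not_mono n)) + k.
Proof.
apply: residue_codegree => // S cS; have [u [_ [uS _ _]]] := two_points cS.
exists [seq x <- iota 0 3 | x != val u %% 3]; split.
- by rewrite filter_uniq ?iota_uniq.
- by rewrite all_filter; apply/allP => x; rewrite mem_iota => x3; apply/implyP.
- have : val u %% 3 < 3 by rewrite ltn_mod.
  by case: (val u %% 3) => [|[|[|]]].
- by move=> v _; rewrite mem_filter => /andP[vu _]; apply: not_mono_extend vu.
Qed.

Lemma min_codegree_label n :
  7 * (n %/ 10) <= min_codegree (pred_kgraph k (fun e => ~~ forbidden_edge (@label10 n) e)) + k.
Proof.
apply: residue_codegree => // S cS; have [u [w [uS wS uw]]] := two_points cS.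
exists [seq x <- iota 0 10 | good_label (label10 u) (label10 w) x]; split.
- by rewrite filter_uniq ?iota_uniq.
- by rewrite all_filter; apply/allP => x; rewrite mem_iota => x3; apply/implyP.
- have chk : all (fun a => all (fun b =>
     7 <= size [seq x <- iota 0 10 | good_label a b x]) (iota 0 10)) (iota 0 10).
    by vm_compute.
  have mem t : t %% 10 \in iota 0 10 by rewrite mem_iota ltn_mod.
  by move/allP/(_ _ (mem u))/allP/(_ _ (mem w)) : chk.
- by move=> v vS; rewrite mem_filter => /andP[vu _]; apply: no_forbidden_edge_extend uw vS vu.
Qed.

(** A residue modulo 30 fixes those modulo 3 and 10 independently, so some residue suits both
    constructions. *)
Lemma min_codegree_overlay n : n %/ 30 <= min_codegree
    (pred_kgraph k (fun e => not_mono e && ~~ forbidden_edge (@label10 n) e)) + k.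
Proof.
rewrite -[X in X <= _]mul1n.
apply: residue_codegree => // S cS; have [u [w [uS wS uw]]] := two_points cS.
pose good c a b x := (x %% 3 != c) && good_label a b (x %% 10).
exists [seq x <- iota 0 30 | good (val u %% 3) (label10 u) (label10 w) x]; split.
- by rewrite filter_uniq ?iota_uniq.
- by rewrite all_filter; apply/allP => x; rewrite mem_iota => x3; apply/implyP.
- have chk : all (fun c => all (fun a => all (fun b =>
     1 <= size [seq x <- iota 0 30 | good c a b x]) (iota 0 10)) (iota 0 10)) (iota 0 3).
    by vm_compute.
  have mem t : t %% 10 \in iota 0 10 by rewrite mem_iota ltn_mod.
  have mem3 : val u %% 3 \in iota 0 3 by rewrite mem_iota ltn_mod.
  by move/allP/(_ _ mem3)/allP/(_ _ (mem u))/allP/(_ _ (mem w)) : chk.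
- move=> v vS; rewrite mem_filter => /andP[/andP[v3 v10] _].
  rewrite !modn_dvdm // in v3 v10.
  by rewrite (not_mono_extend uS) //= (no_forbidden_edge_extend uS wS).
Qed.

End Constructions.

(** * Random sampling and existence of the limit *)

From mathcomp Require Import all_classical all_reals all_analysis.
From mathcomp Require Import ring lra.
Import Order.TTheory GRing.Theory Num.Theory.
Import numFieldNormedType.Exports.

Local Open Scope ring_scope.

Lemma ffact_le_exp n m : (n ^_ m <= n ^ m)%N.
Proof.
elim: m => [//|m IH]; rewrite ffactnSr expnSr leq_mul //; exact: leq_subr.
Qed.

Lemma bin_le_exp n m : ('C(n, m) <= n ^ m)%N.
Proof.
apply: leq_trans (ffact_le_exp n m); rewrite -bin_ffact.
by rewrite leq_pmulr // fact_gt0.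
Qed.

(** Injective maps dominate once [n] is large against [m * m]; multiplying by [n] keeps the estimate
    in [nat]. *)
Lemma exp_le_ffact n m : (n * n ^ m <= n * n ^_ m + m * m * n ^ m)%N.
Proof.
elim: m => [|m IH]; first by rewrite muln1 leq_addr.
rewrite ffactnSr expnSr; have := ffact_le_exp n m.
move: IH; set a := (n ^ m)%N; set b := (n ^_ m)%N => IH ba.
have [nm|/ltnW mn] := leqP n m.
  have : (n * n * a <= m.+1 * m.+1 * a)%N by rewrite leq_mul2r leq_mul ?orbT // ltnW.
  rewrite (eqP nm); nia.
have [d E] : exists d, n = (m + d)%N by exists (n - m)%N; rewrite subnKC.
have -> : (n - m = d)%N by lia.
have := leq_mul (leqnn n) IH; have := leq_mul (leqnn (n * m)) ba; nia.
Qed.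

Section Sampling.
Variables (R : realType) (k m : nat).
Variables (V : finType) (H : kgraph_on k V).

Definition hits (J : {set 'I_m}) (g : {ffun 'I_m -> V}) : nat :=
  #|[set i | (i \notin J) && (g i \in nbhd H (g @: J))]|%SET.

(* With [y = exp(-s)] the left-hand side dominates the number of bad samples.
   Replacing [g @: J] by a free (k-1)-set [S] containing it turns the sum over
   [g] into a product, at the cost of a factor independent of [#|V|]. *)
Lemma sum_hits_le (J : {set 'I_m}) (y p : R) :
  #|J| = k.-1 -> 0 <= y <= 1 ->
  (forall S : {set V}, #|S| = k.-1 -> p * #|V|%:R <= #|nbhd H S|%:R) ->
  p <= 1 -> 
  \sum_(g : {ffun 'I_m -> V} | injectiveb g) y ^+ hits J g <=
  (k.-1 ^ k.-1)%:R * #|V|%:R ^+ m * (1 - p * (1 - y)) ^+ (m - k.-1).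
Proof.
move=> cJ /andP[y0 y1] hN p1.
(* Coordinates in [J] are forced into [S]; every other one has weight [y] on the neighbourhood of
   [S] and 1 elsewhere. *)
pose w (S : {set V}) (i : 'I_m) (v : V) : R :=
  if i \in J then (v \in S)%:R else if v \in nbhd H S then y else 1.
have w0 S i v : 0 <= w S i v by rewrite /w; case: ifP => // _; case: ifP.
have q0 : 0 <= 1 - p * (1 - y) by nra.
have hitsE (g : {ffun 'I_m -> V}) : y ^+ hits J g = \prod_i w (g @: J) i (g i).
  rewrite (bigID (mem J)) /= big1 ?mul1r; last first.
    by move=> i iJ; rewrite /w iJ imset_f.
  rewrite (bigID (fun i => g i \in nbhd H (g @: J))) /= [X in _ * X]big1 ?mulr1; last first.
    by move=> i /andP[iJ /negPf iN]; rewrite /w (negPf iJ) iN.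
  rewrite (eq_bigr (fun=> y)); last by move=> i /andP[/negPf iJ iN]; rewrite /w iJ iN.
  by rewrite prodr_const /hits cardsE.
(* All terms are nonnegative, so the sum may grow to all maps [g] and all [S]; the term [S = g @: J]
   is the original one. *)
apply: (@le_trans _ _ (\sum_(g : {ffun 'I_m -> V}) \sum_(S : {set V} | #|S| == k.-1)
    \prod_i w S i (g i))).
  rewrite [X in _ <= X](bigID (fun g : {ffun _} => injectiveb g)) /=.
  apply: ler_wpDr.
    by apply: sumr_ge0 => g _; apply: sumr_ge0 => S _; apply: prodr_ge0.
  apply: ler_sum => g /injectiveP gI.
  rewrite hitsE (bigD1 (g @: J)) /=; last by rewrite card_imset // cJ.
  by rewrite lerDl; apply: sumr_ge0 => S _; apply: prodr_ge0.
rewrite exchange_big /=.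
apply: (@le_trans _ _ (\sum_(S : {set V} | #|S| == k.-1)
    (k.-1 ^ k.-1)%:R * (#|V|%:R * (1 - p * (1 - y))) ^+ (m - k.-1))).
  (* For fixed [S] the coordinates are independent: the sum of products is a product of sums. *)
  apply: ler_sum => S /eqP cS; rewrite -(bigA_distr_bigA (w S)).
  apply: (@le_trans _ _ (\prod_(i < m)
     (if i \in J then k.-1%:R else #|V|%:R * (1 - p * (1 - y))))).
    apply: ler_prod => i _; rewrite sumr_ge0 //= /w; case: ifP => _.
      rewrite -natr_sum ler_nat -cS -sum1_card [leqRHS]big_mkcond /=.
      by apply: leq_sum => v _; case: (v \in S).
    rewrite (bigID (mem (nbhd H S))) /= (eq_bigr (fun=> y)); last by move=> v ->.
    rewrite [X in _ + X](eq_bigr (fun=> 1)); last by move=> v /negPf->.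
    rewrite !sumr_const.
    have -> : #|[predC nbhd H S]|%:R = #|V|%:R - #|nbhd H S|%:R :> R.
      by rewrite -(cardC (mem (nbhd H S))) natrD addrC addKr.
    have := hN S cS; rewrite -mulr_natr; nra.
  rewrite (bigID (mem J)) /= (eq_bigr (fun=> k.-1%:R)); last by move=> i ->.
  rewrite [X in _ * X](eq_bigr (fun=> #|V|%:R * (1 - p * (1 - y)))); last first.
    by move=> i /negPf->.
  rewrite !prodr_const cJ natrX.
  have -> : #|[predC J]| = (m - k.-1)%N.
    have E : (#|J| + #|[predC J]| = m)%N by rewrite cardC card_ord.
    by rewrite cJ in E; lia.
  by [].
rewrite (eq_bigl (fun S => S \in [set S : {set V} | #|S| == k.-1]%SET)); last first.
  by move=> S; rewrite inE.
rewrite sumr_const card_draws.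
have km : (k.-1 <= m)%N by rewrite -cJ -[leqRHS]card_ord max_card.
have -> : #|V|%:R ^+ m = #|V|%:R ^+ k.-1 * #|V|%:R ^+ (m - k.-1) :> R.
  by rewrite -exprD subnKC.
rewrite -mulr_natl exprMn.
(* The number of sets [S] restores the factor [#|V| ^ k.-1] lost on the coordinates in [J]. *)
have : ('C(#|V|, k.-1))%:R <= #|V|%:R ^+ k.-1 :> R.
  by rewrite -natrX ler_nat bin_le_exp.
have : 0 <= (k.-1 ^ k.-1)%:R * (#|V|%:R ^+ (m - k.-1) * (1 - p * (1 - y)) ^+ (m - k.-1)) :> R.
  by rewrite mulr_ge0 // mulr_ge0 // exprn_ge0.
set a := (k.-1 ^ k.-1)%:R; set b := _ ^+ (m - k.-1); set c := _ ^+ (m - k.-1).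
set d := _%:R; set e := _ ^+ k.-1; nra.
Qed.

End Sampling.

(** From [expR (- s) * (1 + s) <= 1] the right side is at least [s / (1 + s)]. *)
Lemma expRN_le (R : realType) (s : R) : 0 <= s -> s - s ^+ 2 <= 1 - expR (- s).
Proof.
move=> s0; have y0 := expR_gt0 (- s).
have : expR (- s) * (1 + s) <= 1.
  by rewrite -[leRHS](expR0) -(addNr s) expRD ler_pM2l // expR_ge1Dx.
by set y := expR (- s) in y0 *; nra.
Qed.

(** Exponential moments with a union bound over [J]. The bound [2^-1] matches [low]: at least half
    of all maps are injective. *)
Lemma exists_good_sample (R : realType) (k m : nat) (V : finType) (H : kgraph_on k V)
    (p e s : R) :
  0 <= p <= 1 -> 0 <= s -> 
  (forall S : {set V}, #|S| = k.-1 -> p * #|V|%:R <= #|nbhd H S|%:R) ->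
  (2 * (m * m) <= #|V|)%N -> (0 < #|V|)%N ->
  (m ^ k.-1 * k.-1 ^ k.-1)%:R * expR (k%:R - (s * e - s ^+ 2) * m%:R) < 2^-1 :> R ->
  exists g : {ffun 'I_m -> V}, injective g /\
    forall J : {set 'I_m}, #|J| = k.-1 -> (p - e) * m%:R <= (hits H J g)%:R.
Proof.
move=> /andP[p0 p1] s0 hN ltn n0 small; apply: contrapT => nex.
pose y := expR (- s); have y0 : 0 < y := expR_gt0 _.
have y1 : y <= 1 by rewrite -expR0 ler_expR oppr_le0.
have ss : s - s ^+ 2 <= 1 - y by apply: expRN_le.
pose x := p * (1 - y).
have x0 : 0 <= x by rewrite mulr_ge0 // subr_ge0.
have x1 : x <= 1 by rewrite /x; nra.
have low : #|V|%:R ^+ m <= 2 * (#|V| ^_ m)%:R :> R.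
  have hle : (#|V| * #|V| ^ m <= #|V| * (2 * #|V| ^_ m))%N.
    by have := exp_le_ffact #|V| m; have := leq_mul ltn (leqnn (#|V| ^ m)); nia.
  by rewrite leq_pmul2l // in hle; rewrite -natrX -natrM ler_nat.
have up : (#|V| ^_ m)%:R * expR (- (s * ((p - e) * m%:R))) <=
    (m ^ k.-1 * k.-1 ^ k.-1)%:R * #|V|%:R ^+ m * (1 - x) ^+ (m - k.-1).
  apply: (@le_trans _ _ (\sum_(g : {ffun 'I_m -> V} | injectiveb g)
      \sum_(J : {set 'I_m} | #|J| == k.-1) y ^+ hits H J g)).
    have -> : (#|V| ^_ m)%:R = \sum_(g : {ffun 'I_m -> V} | injectiveb g) 1 :> R.
      have := card_inj_ffuns 'I_m V; rewrite card_ord => <-.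
      by rewrite sumr_const cardsE.
    rewrite mulr_suml; apply: ler_sum => g /injectiveP gI; rewrite mul1r.
    (* A bad sample has a set [J] with few hits, whose term alone is at least [y] to the power
       [(p - e) * m]. *)
    have [J [cJ ltJ]] : exists J : {set 'I_m}, #|J| = k.-1 /\
        (hits H J g)%:R < (p - e) * m%:R.
      apply: contrapT => nJ; apply: nex; exists g; split=> // J cJ.
      by rewrite leNgt; apply/negP => ltJ; apply: nJ; exists J.
    rewrite (bigD1 J) /=; last by rewrite cJ.
    apply: ler_wpDr; first by apply: sumr_ge0 => ? _; rewrite exprn_ge0 // ltW.
    by rewrite -expRM_natr ler_expR mulNr lerN2 ler_wpM2l // ltW.
  rewrite exchange_big /=.
  apply: (@le_trans _ _ (\sum_(J : {set 'I_m} | #|J| == k.-1)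
     (k.-1 ^ k.-1)%:R * #|V|%:R ^+ m * (1 - x) ^+ (m - k.-1))).
    by apply: ler_sum => J /eqP cJ; apply: sum_hits_le => //; rewrite y1 ltW.
  rewrite (eq_bigl (fun S => S \in [set S : {set 'I_m} | #|S| == k.-1]%SET)); last first.
    by move=> S; rewrite inE.
  rewrite sumr_const card_draws card_ord -[leLHS]mulr_natl !mulrA natrM.
  rewrite !ler_wpM2r ?exprn_ge0 ?subr_ge0 // ler_nat; exact: bin_le_exp.
have qe : (1 - x) ^+ (m - k.-1) <= expR (k%:R - x * m%:R).
  apply: (@le_trans _ _ (expR (- x) ^+ (m - k.-1))).
    by rewrite lerXn2r ?nnegrE ?subr_ge0 ?expR_ge0 // expR_ge1Dx.
  rewrite -expRM_natr ler_expR.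
  have : m%:R <= (m - k.-1)%:R + k%:R :> R by rewrite -natrD ler_nat; lia.
  have : 0 <= k%:R :> R by [].
  by nra.
have {}up : (#|V| ^_ m)%:R <= #|V|%:R ^+ m *
   ((m ^ k.-1 * k.-1 ^ k.-1)%:R * expR (k%:R - (s * e - s ^+ 2) * m%:R)).
  have c0 : 0 <= (m ^ k.-1 * k.-1 ^ k.-1)%:R :> R by [].
  have V0 : 0 <= #|V|%:R ^+ m :> R by rewrite exprn_ge0.
  rewrite -(ler_pM2r (expR_gt0 (- (s * ((p - e) * m%:R))))).
  have mulE (a b u v : R) : a * (b * u) * v = b * a * (u * v) by ring.
  apply: le_trans up _; rewrite mulE ler_wpM2l //.
  apply: le_trans qe _; rewrite -expRD ler_expR.
  have m0 : 0 <= m%:R :> R by [].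
  (* Together these bound [s * (p - e) - x] by [s ^+ 2 - s * e], the rate in [small]. *)
  have : (s - s ^+ 2) * p <= x by rewrite /x mulrC ler_wpM2l.
  have : s ^+ 2 * p <= s ^+ 2 by rewrite ler_piMr // sqr_ge0.
  move: m0; set M := m%:R; nra.
have Vm : 0 < #|V|%:R ^+ m :> R by rewrite exprn_gt0 // ltr0n.
move: small up low Vm; set a := #|V|%:R ^+ m; set b := _%:R; set c := _ * expR _.
nra.
Qed.

(** The choice [s = e / 2] maximises [s * e - s ^+ 2], giving [e ^+ 2 / 4]. The degree-[k] term of
    the exponential series then beats [m ^ k.-1]. *)
Lemma chernoff_small (R : realType) (k : nat) (e : R) : (0 < k)%N -> 0 < e ->
  exists m0 : nat, forall m : nat, (m0 <= m)%N ->
  (m ^ k.-1 * k.-1 ^ k.-1)%:R * expR (k%:R - (e / 2 * e - (e / 2) ^+ 2) * m%:R) < 2^-1 :> R.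
Proof.
move=> k0 e0; pose d := e ^+ 2 / 4; have d0 : 0 < d by rewrite divr_gt0 // exprn_gt0.
have dE : e / 2 * e - (e / 2) ^+ 2 = d by rewrite /d; field.
pose C := 2 * (k.-1 ^ k.-1)%:R * expR k%:R * k`!%:R / d ^+ k.
have C0 : 0 <= C.
  apply: divr_ge0; last by rewrite exprn_ge0 // ltW.
  by rewrite !mulr_ge0 ?expR_ge0.
exists (Num.bound C).+1 => m ltm; rewrite dE.
have mC : C <= m%:R.
  apply: le_trans (ltW (archi_boundP C0)) _; rewrite ler_nat; exact: ltnW.
have m0 : 0 < m%:R :> R by rewrite ltr0n; apply: leq_ltn_trans ltm.
have := expR_ge1Dxn k.-1 (ltW (mulr_gt0 d0 m0)); rewrite prednK // => expm.
have dk : 0 < d ^+ k / k`!%:R by rewrite divr_gt0 ?exprn_gt0 // ltr0n fact_gt0.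
have CE : C * (d ^+ k / k`!%:R) = 2 * (k.-1 ^ k.-1)%:R * expR k%:R.
  have : k`!%:R != 0 :> R by rewrite pnatr_eq0 -lt0n fact_gt0.
  have : d ^+ k != 0 by rewrite gt_eqF ?exprn_gt0.
  rewrite /C; set x := d ^+ k; set y := k`!%:R => x0 y0; field.
  by rewrite x0 y0.
have main : (m%:R ^+ k.-1) * (2 * (k.-1 ^ k.-1)%:R * expR k%:R) < expR (d * m%:R).
  apply: lt_le_trans expm; apply: (@le_lt_trans _ _ ((d * m%:R) ^+ k / k`!%:R)).
    have mE : m%:R ^+ k = m%:R * m%:R ^+ k.-1 :> R by rewrite -exprS prednK.
    rewrite -CE (exprMn k d) mE.
    have -> : d ^+ k * (m%:R * m%:R ^+ k.-1) / k`!%:R =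
        m%:R ^+ k.-1 * (m%:R * (d ^+ k / k`!%:R)) by ring.
    by rewrite ler_wpM2l ?exprn_ge0 // ler_pM2r.
  by rewrite ltrDr.
rewrite expRB mulrA ltr_pdivrMr ?expR_gt0 // natrM natrX.
move: main; set a := m%:R ^+ k.-1; set b := _%:R; set c := expR _; set f := expR _.
by move=> ?; lra.
Qed.

(** * Codegree numbers under sampling, and convergence *)

Lemma ler_min_codegree (R : realType) (k : nat) (V : finType) (H : kgraph_on k V) (x : R) :
  x <= #|V|%:R -> (forall S : {set V}, #|S| = k.-1 -> x <= (codegree H S)%:R) ->
  x <= (min_codegree H)%:R.
Proof.
move=> xV xS; rewrite /min_codegree; elim/big_ind: _ => // [a b xa xb|S /eqP/xS//].
by rewrite /minn; case: ifP.
Qed.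

(** The hypothesis [0 <= x] covers a maximum over no graphs. *)
Lemma co_ex_ler (R : realType) (k n : nat) (Fam : set (kgraph k)) (x : R) : 0 <= x ->
  (forall H : kgraph_on k 'I_n, Defs.free Fam H -> (min_codegree H)%:R <= x) ->
  (co_ex Fam n)%:R <= x.
Proof.
move=> x0 xH; rewrite /co_ex; elim/big_ind: _ => // [a b xa xb|H /asboolP/xH//].
by rewrite /maxn; case: ifP.
Qed.

Lemma min_codegree_le_co_ex (k n : nat) (Fam : set (kgraph k)) (H : kgraph_on k 'I_n) :
  Defs.free Fam H -> (min_codegree H <= co_ex Fam n)%N.
Proof.
by move=> fH; apply: (@leq_bigmax_cond _ _ _ H); apply/asboolP.
Qed.

(** For injective [g] this is the subgraph induced on the image of [g], relabelled by [X]. *)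
Definition pullback (k : nat) (X V : finType) (g : X -> V) (H : kgraph_on k V) :
  kgraph_on k X := pred_kgraph k (fun e : {set X} => g @: e \in edges H).

Lemma free_pullback (k : nat) (X V : finType) (g : X -> V) (H : kgraph_on k V)
    (Fam : set (kgraph k)) : injective g -> Defs.free Fam H -> Defs.free Fam (pullback g H).
Proof.
move=> gI fH F /fH nF [f fI fE]; apply: nF; exists (g \o f); first exact: inj_comp.
by move=> e /fE; rewrite inE => /andP[_]; rewrite -imset_comp.
Qed.

Lemma codegree_pullback (k m : nat) (V : finType) (g : {ffun 'I_m -> V})
    (H : kgraph_on k V) (J : {set 'I_m}) :
  (0 < k)%N -> injective g -> #|J| = k.-1 -> codegree (pullback g H) J = hits H J g.
Proof.
move=> k0 gI cJ; rewrite codegreeE // pred_nbhd //; apply: eq_card => i.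
by rewrite !inE imsetU1 mem_imset //; case: (i \in J).
Qed.

Lemma co_ex_sample (R : realType) (k : nat) (Fam : set (kgraph k)) (e : R) :
  (0 < k)%N -> 0 < e ->
  exists m0 : nat, forall m : nat, (m0 <= m)%N -> exists n0 : nat, forall n : nat,
    (n0 <= n)%N -> (co_ex Fam n)%:R / n%:R <= (co_ex Fam m)%:R / m%:R + e :> R.
Proof.
move=> k0 e0; have [m0 small] := chernoff_small k0 e0.
exists m0.+1 => m ltm; exists (2 * (m * m)).+1 => n ltn.
have n0 : 0 < n%:R :> R by rewrite ltr0n; apply: leq_ltn_trans ltn.
have mp : 0 < m%:R :> R by rewrite ltr0n; apply: leq_ltn_trans ltm.
have u0 : 0 <= (co_ex Fam m)%:R / m%:R :> R by rewrite divr_ge0.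
rewrite ler_pdivrMr //; apply: co_ex_ler.
  by rewrite mulr_ge0 // addr_ge0 // ltW.
move=> H fH; rewrite -ler_pdivrMr //.
set p := (min_codegree H)%:R / n%:R; have p1 : 0 <= p <= 1.
  rewrite divr_ge0 //= ler_pdivrMr // mul1r ler_nat.
  by have := min_codegree_leV H k0; rewrite card_ord.
have hN (S : {set 'I_n}) : #|S| = k.-1 -> p * #|'I_n|%:R <= #|nbhd H S|%:R.
  move=> cS; rewrite card_ord divfK ?gt_eqF // ler_nat -codegreeE //.
  exact: min_codegree_le.
have e20 : 0 <= e / 2 by rewrite divr_ge0 // ltW.
have [||g [gI hg]] := exists_good_sample p1 e20 hN _ _ (small m (ltnW ltm)).
- by rewrite card_ord ltnW.
- by rewrite card_ord; apply: leq_ltn_trans ltn.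
have : (p - e) * m%:R <= (min_codegree (pullback g H))%:R.
  apply: ler_min_codegree => [|J cJ]; last by rewrite codegree_pullback ?hg.
  by rewrite card_ord ler_piMl // lerBlDr; have /andP[_ /le_trans->] := p1; rewrite // lerDl ltW.
have : (min_codegree (pullback g H))%:R <= (co_ex Fam m)%:R :> R.
  by rewrite ler_nat; apply: min_codegree_le_co_ex; apply: free_pullback.
move=> h1 /le_trans/(_ h1); rewrite -ler_pdivlMr //; lra.
Qed.

Local Open Scope classical_set_scope.

(** The limit is the upper limit, the infimum of [E]: each late [u m + e] is an eventual upper
    bound, so [u m] cannot fall below that infimum by more than [e]. *)
Lemma cvgn_of_sample (R : realType) (u : nat -> R) : (forall n, 0 <= u n <= 1) ->
  (forall e : R, 0 < e -> exists m0 : nat, forall m, (m0 <= m)%N ->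
    exists n0 : nat, forall n, (n0 <= n)%N -> u n <= u m + e) ->
  cvgn u.
Proof.
move=> u01 hu.
pose E : set R := [set x | exists n0 : nat, forall n, (n0 <= n)%N -> u n <= x].
have E0 : lbound E 0.
  by move=> x [n0 /(_ n0 (leqnn _))]; apply: le_trans; have /andP[] := u01 n0.
have E1 : E 1 by exists 0%N => n _; have /andP[] := u01 n.
have infE : has_inf E by split; [exists 1|exists 0].
apply/cvg_ex; exists (inf E); apply/cvgrPdist_le => e e0.
have [x [n0 ux] xE] := inf_adherent e0 infE.
have [m0 um] := hu e e0.
near=> n.
have n0n : (n0 <= n)%N by near: n; exists n0.
have m0n : (m0 <= n)%N by near: n; exists m0.
have : inf E <= u n + e by apply: ge_inf; [exists 0|exact: um].
have := ux n n0n; rewrite ler_norml; lra.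
Unshelve. all: by end_near.
Qed.

Section Density.
Variables (R : realType) (k : nat) (k_gt0 : (0 < k)%N) (Fam : set (kgraph k)).

Let u (n : nat) : R := (co_ex Fam n)%:R / n%:R.

Lemma codegree_density_cvg : cvgn u.
Proof.
apply: cvgn_of_sample => [n|e e0]; last exact: co_ex_sample.
rewrite divr_ge0 //=; case: n => [|n]; first by rewrite /u invr0 mulr0.
rewrite ler_pdivrMr ?ltr0n // mul1r; apply: co_ex_ler => // H _.
by rewrite ler_nat; have := min_codegree_leV H k_gt0; rewrite card_ord.
Qed.

Lemma codegree_density_ge (a q C : nat) (c : R) : (0 < q)%N -> c < a%:R / q%:R ->
  (forall n, a * (n %/ q) <= co_ex Fam n + C)%N -> c <= codegree_density R Fam.
Proof.
move=> q0 ca h; apply: limr_ge; first exact: codegree_density_cvg.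
have d0 : 0 < a%:R / q%:R - c by rewrite subr_gt0.
have B0 : 0 <= (a + C)%:R / (a%:R / q%:R - c) by rewrite divr_ge0 // ltW.
(* From here on the slack [n * (a / q - c)] absorbs [C] and the loss of at most [a] from rounding
   [n / q] down. *)
exists (Num.bound ((a + C)%:R / (a%:R / q%:R - c))).+1 => // n /= ltn.
have n0 : 0 < n%:R :> R by rewrite ltr0n; apply: leq_ltn_trans ltn.
have qp : 0 < q%:R :> R by rewrite ltr0n.
have : (a + C)%:R <= n%:R * (a%:R / q%:R - c).
  rewrite -ler_pdivrMr //; apply: le_trans (ltW (archi_boundP B0)) _.
  by rewrite ler_nat ltnW.
rewrite ler_pdivlMr //.
have : a%:R * (n %/ q)%:R <= (co_ex Fam n)%:R + C%:R :> R.
  by rewrite -natrM -natrD ler_nat.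
have : n%:R / q%:R <= (n %/ q)%:R + 1 :> R.
  rewrite ler_pdivrMr // natr1 -natrM ler_nat.
  by have := divn_eq n q; have := ltn_pmod n q0; rewrite mulSn; lia.
rewrite natrD => h1 h2 h3.
have := ler_wpM2l (ler0n R a) h1; nra.
Qed.

Lemma codegree_density_le (n0 : nat) (c : R) :
  (forall n, (n0 < n)%N -> (co_ex Fam n)%:R <= c * n%:R) -> codegree_density R Fam <= c.
Proof.
move=> h; apply: limr_le; first exact: codegree_density_cvg.
exists n0.+1 => // n /= ltn; rewrite ler_pdivrMr ?h //.
by rewrite ltr0n; apply: leq_ltn_trans ltn.
Qed.

End Density.

(** * The two densities *)

Section NonPrincipal.
Variables (R : realType) (k : nat) (hk : (3 <= k)%N).

Let k_gt0 : (0 < k)%N. Proof. exact: leq_trans hk. Qed.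
(** [M] exceeds [p.+1 * k] for both suspensions, the larger case being three colours; [L] is the
    least value allowed by [not_emb_layers]. *)
Let M := (3 * k).+1.
Let L := (1000 * k).+1.
Let G := suspension M k_gt0 (suspension M k_gt0 (single_edge k)).

Definition tower : kgraph k := ord_kgraph G.
Definition ladder : kgraph k := ord_kgraph (layers L k_gt0).

Lemma tower_not_colorable : not_colorable 'I_3 G 3.
Proof.
apply: not_colorable_suspension => //; apply: not_colorable_suspension.
  by rewrite /M; lia.
exact: not_colorable_single_edge.
Qed.

Lemma not_mono_tower_free n (P : pred {set 'I_n}) :
  (forall e, P e -> not_mono e) -> ~ contains (pred_kgraph k P) tower.
Proof.
move=> hP /contains_ord.
pose c (v : 'I_n) : 'I_3 := inord (v %% 3).
apply: (not_emb_colored (c := c) _ tower_not_colorable); first by rewrite card_ord.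
move=> e; rewrite inE => /andP[_ /hP /existsP[x /andP[xe /existsP[y /andP[ye xy]]]]].
exists x, y; split=> //; apply: contra xy => /eqP/(congr1 val).
by rewrite /= !inordK ?ltn_mod // => ->.
Qed.

Lemma label_ladder_free n (P : pred {set 'I_n}) :
  (forall e, P e -> ~~ forbidden_edge (@label10 n) e) -> ~ contains (pred_kgraph k P) ladder.
Proof.
move=> hP /contains_ord; apply: (@not_emb_layers _ _ _ _ _ (@label10 n)) => //.
  by move=> v; rewrite ltn_mod.
by move=> e; rewrite inE => /andP[_ /hP].
Qed.

Lemma density_tower_ge (c : R) : c < 2 / 3 -> c <= codegree_density R [set tower].
Proof.
move=> c23; apply: (codegree_density_ge k_gt0 (a := 2) (q := 3) (C := k)) => // n.
apply: leq_trans (min_codegree_not_mono hk n) _; rewrite leq_add2r.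
by apply: min_codegree_le_co_ex => F ->; apply: not_mono_tower_free.
Qed.

Lemma density_ladder_ge (c : R) : c < 7 / 10 -> c <= codegree_density R [set ladder].
Proof.
move=> c23; apply: (codegree_density_ge k_gt0 (a := 7) (q := 10) (C := k)) => // n.
apply: leq_trans (min_codegree_label hk n) _; rewrite leq_add2r.
by apply: min_codegree_le_co_ex => F ->; apply: label_ladder_free.
Qed.

Lemma density_joint_ge (c : R) : c < 1 / 30 ->
  c <= codegree_density R [set tower; ladder].
Proof.
move=> c30; apply: (codegree_density_ge k_gt0 (a := 1) (q := 30) (C := k)) => // n.
rewrite mul1n; apply: leq_trans (min_codegree_overlay hk n) _; rewrite leq_add2r.
apply: min_codegree_le_co_ex => F [] ->.
  by apply: not_mono_tower_free => e /andP[].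
by apply: label_ladder_free => e /andP[].
Qed.

Lemma density_joint_le : exists2 eta : R, 0 < eta &
  codegree_density R [set tower; ladder] <= 2 / 3 - eta.
Proof.
pose c := (M + #|subs k M| * (M + #|subs k M| * k) + #|subs k M| * k)%N.
pose K := #|{: 'I_3 * {set 'I_L}}|.
(* The condition of [joint_upper_bound] at [d = (2 / 3 - eta) * n] reads [(3 * K + 2) * eta * n]
   plus a constant [< n / 3]. This [eta] uses up [n / 6], and the bound on [n] leaves the other
   [n / 6] for the constant. *)
pose eta : R := (6 * (3 * K%:R + 2))^-1.
have K0 : 0 <= K%:R :> R by [].
have eta0 : 0 < eta by rewrite invr_gt0; lra.
have etaE : (3 * K%:R + 2) * eta = 1 / 6.
  by rewrite /eta; field; rewrite gt_eqF //; lra.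
exists eta => //; apply: (codegree_density_le k_gt0 (n0 := 6 * (2 * c + M + L + K * (2 * c)))).
move=> n ltn; apply: co_ex_ler => [|H fH].
  rewrite mulr_ge0 // subr_ge0.
  have : 0 <= K%:R * eta by rewrite mulr_ge0 // ltW.
  by lra.
set d := min_codegree H; rewrite leNgt; apply/negP => dn.
have : contains H ladder.
  apply/contains_ord; apply: (@joint_upper_bound k M k_gt0 _ H L c d).
  - by rewrite /c; lia.
  - by rewrite /c; lia.
  - exact: min_codegree_leV.
  - by move=> S cS; rewrite -codegreeE //; apply: min_codegree_le.
  - rewrite card_ord -/K -(ltr_nat R) !natrD !natrM.
    have : (2 * n + 2 * c - 3 * d)%:R <= 3 * eta * n%:R + 2 * c%:R :> R.
      have [le|/ltnW ge] := leqP (2 * n + 2 * c) (3 * d).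
        by rewrite (eqP le) addr_ge0 // mulr_ge0 // mulr_ge0 // ltW.
      by rewrite natrB // natrD !natrM; lra.
    move/(ler_wpM2l K0).
    move: ltn; rewrite -(ltr_nat R) !(natrM, natrD) => ltn.
    have : (3 * K%:R + 2) * eta * n%:R = 1 / 6 * n%:R by rewrite etaE.
    move: ltn dn; set x := (_ - _)%:R; lra.
  - by move/contains_ord; apply: fH; left.
by apply: fH; right.
Qed.

End NonPrincipal.

Theorem theorem1p3 (R : realType) (k : nat) (hk : (3 <= k)%N) :
  exists F1 F2 : kgraph k,
    0 < codegree_density R [set F1; F2] <
      Num.min (codegree_density R [set F1]) (codegree_density R [set F2]).
Proof.
have [eta eta0 joint] := density_joint_le R hk.
exists (tower hk), (ladder hk); apply/andP; split.
  by apply: (@lt_le_trans _ _ (1 / 60)); [|apply: density_joint_ge]; lra.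
apply: le_lt_trans joint _; rewrite lt_min; apply/andP; split.
  (* The tower bound holds for every [c < 2 / 3], so a value strictly between [2 / 3 - eta] and
     [2 / 3] is inserted. *)
  by apply: (@lt_le_trans _ _ (2 / 3 - eta / 2)); [|apply: density_tower_ge]; lra.
by apply: (@lt_le_trans _ _ (2 / 3)); [|apply: density_ladder_ge]; lra.
Qed.
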